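(* Let $\mathfrak{A}$ be a unital $C^*$-algebra, $a\in\mathfrak{A}$ a nonzero positive element, and let $x\in\mathfrak{A}_a$. Then $$\frac12\|x\|_a+\frac14\Big|\left\|x+ix^{\sharp_a}\right\|_a-\left\|x-ix^{\sharp_a}\right\|_a\Big|\le v_a(x).$$
   Context: $\mathcal{S}(\mathfrak{A})$ is the set of states of $\mathfrak{A}$ and $\mathcal{S}_a(\mathfrak{A})=\{f/f(a): f\in\mathcal{S}(\mathfrak{A}),\ f(a)\ne 0\}$. For $x\in\mathfrak{A}$, $\|x\|_a=\sup\{\sqrt{f(x^*ax)}: f\in\mathcal{S}_a(\mathfrak{A})\}\in[0,\infty]$, and the $a$-numerical radius is $v_a(x)=\sup\{|f(ax)|: f\in\mathcal{S}_a(\mathfrak{A})\}$. An element $x^{\sharp_a}\in\mathfrak{A}$ is an $a$-adjoint of $x$ if $ax^{\sharp_a}=x^*a$; $\mathfrak{A}_a$ is the set of all elements of $\mathfrak{A}$ admitting an $a$-adjoint (a subalgebra of $\mathfrak{A}$ on which $\|\cdot\|_a$ is a finite semi-norm). $a$-adjoints need not be unique; $x^{\sharp_a}$ denotes an $a$-adjoint of $x$, and the quantities in the claim do not depend on the choice. *)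

(* Defs.v *)
From mathcomp Require Import all_boot all_order all_algebra.
From mathcomp Require Import all_classical all_reals all_analysis.
From mathcomp Require Export complex.

Set Implicit Arguments.
Unset Strict Implicit.
Unset Printing Implicit Defensive.

Import Order.TTheory GRing.Theory Num.Theory.

Local Open Scope classical_set_scope.
Local Open Scope ring_scope.

(* Unital complex C*-algebras, over the library's unital associative algebras
   (which are nonzero rings).  The norm and its completeness are spelled out
   because MathComp-Analysis has no join of rings with normed modules, and HB
   refuses to add one since numDomainType already inherits from both a ring and
   a normed Z-module.  Nonnegativity of the norm follows from cnorm_triangle
   and cnormZ. *)
Record cstarAlgebra (R : realType) := CStarAlgebra {
  cstar_sort :> algType R[i] ;
  cnorm : cstar_sort -> R ;
  star : cstar_sort -> cstar_sort ;
  cnorm_triangle : forall y z, cnorm (y + z) <= cnorm y + cnorm z ;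
  cnormZ : forall (c : R[i]) y,
    cnorm (c *: y) = Normc.normc c * cnorm y ;
  cnorm_eq0 : forall y, cnorm y = 0 -> y = 0 ;
  cnorm_complete : forall u : nat -> cstar_sort,
    (forall e : R, 0 < e -> exists N : nat, forall m n : nat,
       (N <= m)%N -> (N <= n)%N -> cnorm (u m - u n) < e) ->
    exists l, forall e : R, 0 < e -> exists N : nat, forall n : nat,
       (N <= n)%N -> cnorm (u n - l) < e ;
  cnormM : forall y z, cnorm (y * z) <= cnorm y * cnorm z ;
  starK : forall y, star (star y) = y ;
  starD : forall y z, star (y + z) = star y + star z ;
  starZ : forall (c : R[i]) y, star (c *: y) = conjc c *: star y ;
  starM : forall y z, star (y * z) = star z * star y ;
  cnorm_star_mul : forall y, cnorm (star y * y) = cnorm y ^+ 2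
}.

Section ANumericalRadius.
Variables (R : realType) (A : cstarAlgebra R).
Implicit Types (a x y : A).

Definition cstar_positive a : Prop := exists b : A, a = star b * b.

(* In R[i], 0 <= z means that z is real and nonnegative. *)
Definition positive_functional (f : {scalar A}) : Prop :=
  forall y, cstar_positive y -> 0 <= f y.

Definition functional_norm (f : {scalar A}) : \bar R :=
  ereal_sup [set (Normc.normc (f y))%:E | y in [set y | cnorm y <= 1]].

Definition state (f : {scalar A}) : Prop :=
  positive_functional f /\ functional_norm f = 1%:E.

Definition a_states a : set (A -> R[i]) :=
  [set g | exists f : {scalar A},
     [/\ state f, f a != 0 & g = (fun y => f y / f a)]].

(* For a positive and g in a_states a, g (star x * a * x) is a nonnegative
   real; complex.Re only casts it from R[i] to R. *)
Definition a_norm a x : \bar R :=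
  ereal_sup [set (Num.sqrt (complex.Re (g (star x * a * x))))%:E
            | g in a_states a].

Definition a_numerical_radius a x : \bar R :=
  ereal_sup [set (Normc.normc (g (a * x)))%:E | g in a_states a].

Definition a_adjoint a x y : Prop := a * y = star x * a.

Definition a_adjointable a : set A := [set x | exists y, a_adjoint a x y].

End ANumericalRadius.

(* Main.v *)
Require Import Defs.
From HB Require Import structures.
From mathcomp Require Import all_boot all_order all_algebra.
From mathcomp Require Import ring lra.
From mathcomp Require Import all_classical all_reals all_analysis.

(* For z with a z self-adjoint one has ||z||_a <= v_a(z): if f is an a-state,
   then so is f(c^* . c) / f(c^* a c), hence |f(c^* a z c)| <= v_a(z) f(c^* a c)
   for every c, and polarization with c = s + z and c = s - z bounds f(z^* a z).
   Now a (x + i x^#) and a (x - i x^#) are self-adjoint up to a unit scalar, so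
   p := ||x + i x^#||_a and q := ||x - i x^#||_a are at most 2 v_a(x), while
   ||x||_a <= (p + q) / 2.  The left-hand side is thus at most max(p, q) / 2. *)

Import Order.TTheory GRing.Theory Num.Theory.

Local Open Scope classical_set_scope.
Local Open Scope ring_scope.

Section PositiveFunctionals.
Set Implicit Arguments.
Unset Strict Implicit.
Unset Printing Implicit Defensive.
Context {R : realType} {A : cstarAlgebra R}.
Implicit Types (a b c u v y z : A) (k : R[i]) (phi : {scalar A}).

(** * Elementary facts on the involution, the norm and the complex modulus *)

Lemma star1 : star (1 : A) = 1.
Proof. by have := starM (star 1) (1 : A); rewrite !starK !mulr1 starK. Qed.

Lemma starN y : star (- y) = - star y.
Proof. by rewrite -scaleN1r starZ rmorphN rmorph1 scaleN1r. Qed.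

Lemma cnormN y : cnorm (- y) = cnorm y.
Proof. by rewrite -scaleN1r cnormZ normcN Normc.normc1 mul1r. Qed.

Lemma cnorm0 : cnorm (0 : A) = 0.
Proof. by rewrite -(scale0r (0 : A)) cnormZ Normc.normc0 mul0r. Qed.

Lemma cnorm_ge0 y : 0 <= cnorm y.
Proof. by have := cnorm_triangle y (- y); rewrite subrr cnormN cnorm0; lra. Qed.

(** The C*-identity makes the norm of 1 equal to its own square, and this norm is nonzero because
    the algebra is. *)
Lemma cnorm1 : cnorm (1 : A) = 1.
Proof.
have := cnorm_star_mul (1 : A); rewrite star1 mulr1 expr2 => /esym.
have n0 : cnorm (1 : A) != 0.
  by apply/eqP => /cnorm_eq0 /eqP; rewrite oner_eq0.
by rewrite -[RHS]mulr1 => /(mulfI n0).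
Qed.

Lemma normc_sqr k : Normc.normc k ^+ 2 = complex.Re k ^+ 2 + complex.Im k ^+ 2.
Proof. by case: k => r i /=; rewrite sqr_sqrtr // addr_ge0 ?sqr_ge0. Qed.

Lemma normc_ge0 k : 0 <= Normc.normc k.
Proof. by case: k => r i /=; exact: sqrtr_ge0. Qed.

Lemma normc_real (r : R) : Normc.normc (r%:C)%C = `|r|.
Proof. by rewrite /= expr0n addr0 sqrtr_sqr. Qed.

Lemma Re_le_normc k : complex.Re k <= Normc.normc k.
Proof.
case: k => r i /=; rewrite (le_trans (ler_norm r)) // -sqrtr_sqr ler_sqrt.
  by rewrite lerDl sqr_ge0.
by rewrite addr_ge0 ?sqr_ge0.
Qed.

Lemma normc_conj k : Normc.normc (conjc k) = Normc.normc k.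
Proof. by case: k => r i /=; rewrite sqrrN. Qed.

(** * The sesquilinear form [phi (star u * v)] of a positive functional *)

Lemma form_expand phi k u v :
  phi (star (u + k *: v) * (u + k *: v)) =
  phi (star u * u) + k * phi (star u * v) + conjc k * phi (star v * u)
  + conjc k * k * phi (star v * v).
Proof.
have -> : star (u + k *: v) * (u + k *: v) = star u * u + k *: (star u * v)
    + conjc k *: (star v * u) + (conjc k * k) *: (star v * v).
  by rewrite starD starZ !mulrDl !mulrDr -!scalerAl -!scalerAr scalerA !addrA.
by rewrite !linearD !linearZ.
Qed.

Lemma pos_form phi u : positive_functional phi -> 0 <= phi (star u * u).
Proof. by move=> pphi; apply: pphi; exists u. Qed.

(** Positivity at u + v and at u + i v kills two imaginary parts, which compares the imaginary and
    the real parts of both sides. *)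
Lemma form_conj phi u v : positive_functional phi ->
  phi (star u * v) = conjc (phi (star v * u)).
Proof.
move=> pphi.
have := pos_form (u + 'i%C *: v) pphi; have := pos_form (u + 1 *: v) pphi.
rewrite !form_expand rmorph1 !mul1r.
move: (pos_form u pphi) (pos_form v pphi); rewrite !lecE /=.
case: (phi (star u * u)) (phi (star v * v)) => p p' [q q'] /=.
case: (phi (star u * v)) (phi (star v * u)) => [r r'] [t t'] /=.
case/andP=> /eqP-> _ /andP[/eqP-> _] /andP[/eqP h1 _] /andP[/eqP h2 _].
by apply/eqP; rewrite eq_complex /=; apply/andP; split; apply/eqP; lra.
Qed.

Lemma form_CauchySchwarz phi u v : positive_functional phi ->
  Normc.normc (phi (star v * u)) ^+ 2 <=
  complex.Re (phi (star v * v)) * complex.Re (phi (star u * u)).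
Proof.
move=> pphi.
have pos k := pos_form (u + k *: v) pphi.
move: (pos_form u pphi) (pos_form v pphi) pos (form_conj u v pphi) => pu pv pos E.
have {}pos k : 0 <= phi (star u * u) + k * conjc (phi (star v * u))
    + conjc k * phi (star v * u) + conjc k * k * phi (star v * v).
  by rewrite -E -form_expand.
rewrite normc_sqr; move: pu pv pos; rewrite !lecE /=.
case: (phi (star u * u)) (phi (star v * v)) => p p' [q q'] /=.
case: (phi (star v * u)) => [r t] /=.
case/andP=> /eqP-> p0 /andP[/eqP-> q0] pos.
have {}pos (s : R) : 0 <= p - 2 * s * (r ^+ 2 + t ^+ 2)
    + s ^+ 2 * (r ^+ 2 + t ^+ 2) * q.
  (* Taking [k] to be -s times [phi (star v * u)] turns positivity into a real quadratic inequality
     in s. *)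
  have := pos (- s * r +i* (- s * t))%C.
  rewrite lecE /= => /andP[_] /le_trans; apply.
  by rewrite le_eqVlt; apply/orP; left; apply/eqP; ring.
set n := r ^+ 2 + t ^+ 2 in pos *.
have n0 : 0 <= n by rewrite addr_ge0 ?sqr_ge0.
have [q00|q00] := eqVneq q 0.
  have [->|nn0] := eqVneq n 0; first by rewrite mulr_ge0.
  (* For q = 0 the expression is affine in s; this s gives it the value -1. *)
  have := pos ((p + 1) / (2 * n)); rewrite q00 mulr0 addr0.
  suff -> : 2 * ((p + 1) / (2 * n)) * n = p + 1 by lra.
  by field.
(* The quadratic is minimal at s = 1/q. *)
have := pos q^-1; have -> : p - 2 * q^-1 * n + q^-1 ^+ 2 * n * q = p - n / q by field.
have qp : 0 < q by rewrite lt_def q00.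
by rewrite subr_ge0 ler_pdivrMr // mulrC.
Qed.

Lemma form_Minkowski phi u v : positive_functional phi ->
  Num.sqrt (complex.Re (phi (star (u + v) * (u + v)))) <=
  Num.sqrt (complex.Re (phi (star u * u))) +
  Num.sqrt (complex.Re (phi (star v * v))).
Proof.
move=> pphi; have CS := form_CauchySchwarz v u pphi.
rewrite -[X in _ + X]scale1r form_expand rmorph1 !mul1r (form_conj v u pphi).
move: (pos_form u pphi) (pos_form v pphi) (Re_le_normc (phi (star u * v)))
  (normc_ge0 (phi (star u * v))) CS; rewrite !lecE /=.
set n := Normc.normc _.
case: (phi (star u * u)) (phi (star v * v)) => p p' [q q'] /=.
case: (phi (star u * v)) => [r t] /=.
case/andP=> _ p0 /andP[_ q0] rn n0 CS.
have s0 : 0 <= Num.sqrt p + Num.sqrt q by rewrite addr_ge0 ?sqrtr_ge0.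
rewrite -[leRHS](ger0_norm s0) -sqrtr_sqr ler_wsqrtr // sqrrD !sqr_sqrtr //.
suff : n <= Num.sqrt p * Num.sqrt q by rewrite mulr2n; lra.
rewrite -sqrtrM // -(ger0_norm n0) -sqrtr_sqr ler_wsqrtr //.
Qed.

(** * Bounded functionals, compressions and states *)

(** Carried alongside positivity: states have it by their norm and compressions inherit it, so
    automatic continuity is never invoked. *)
Definition bounded_functional phi :=
  exists K : R, forall y, Normc.normc (phi y) <= K * cnorm y.

(** Serves two purposes: [c] = 1 rescales [phi], and [k] = 1 conjugates its argument by [c]. *)
Definition compression phi c k : A -> R[i] :=
  fun y => k * phi (star c * y * c).

Lemma compression_is_scalar phi c k : scalar (compression phi c k).
Proof.
move=> l y z; rewrite /compression mulrDr mulrDl -scalerAr -scalerAl linearP /=.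
by rewrite mulrDr mulrCA.
Qed.

HB.instance Definition _ phi c k :=
  GRing.isLinear.Build R[i] A R[i] _ (compression phi c k)
    (compression_is_scalar phi c k).

Lemma compression_pos phi c k : 0 <= k -> positive_functional phi ->
  positive_functional (compression phi c k).
Proof.
move=> k0 pphi _ [b ->]; apply: mulr_ge0 => //.
by rewrite -!mulrA mulrA -starM; exact: pos_form.
Qed.

Lemma compression_bounded phi c k : bounded_functional phi ->
  bounded_functional (compression phi c k).
Proof.
move=> [K bK]; exists (Normc.normc k * (`|K| * (cnorm (star c) * cnorm c))) => y.
rewrite Normc.normcM -(mulrA (Normc.normc k)) ler_wpM2l ?normc_ge0 //.
apply: le_trans (bK _) _; apply: le_trans (ler_wpM2r (cnorm_ge0 _) (ler_norm K)) _.
rewrite -[leRHS]mulrA ler_wpM2l //; apply: le_trans (cnormM _ _) _.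
rewrite mulrAC ler_wpM2r ?cnorm_ge0 //; exact: cnormM.
Qed.

Lemma state_bounded phi : state phi -> bounded_functional phi.
Proof.
move=> [_ n1]; exists 1 => y; rewrite mul1r.
have [->|y0] := eqVneq y 0; first by rewrite linear0 Normc.normc0 cnorm_ge0.
have ny : 0 < cnorm y.
  by rewrite lt_def cnorm_ge0 andbT; apply: contra y0 => /eqP/cnorm_eq0->.
have : ((Normc.normc (phi (((cnorm y)^-1)%:C%C *: y)))%:E <= functional_norm phi)%E.
  apply: ereal_sup_ubound; exists (((cnorm y)^-1)%:C%C *: y) => //=.
  by rewrite cnormZ normc_real ger0_norm ?invr_ge0 ?cnorm_ge0// mulVf ?gt_eqF.
rewrite n1 lee_fin linearZ /= Normc.normcM normc_real ger0_norm ?invr_ge0 ?cnorm_ge0//.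
by rewrite mulrC ler_pdivrMr // mul1r.
Qed.

(* The supremum s of |phi| over the unit ball satisfies s ^ 2 <= s, since
   |phi y| ^ 2 <= phi (y^* y) and y^* y lies in the unit ball again. *)
Lemma unital_state phi : positive_functional phi -> bounded_functional phi ->
  phi 1 = 1 -> state phi.
Proof.
move=> pphi [K bK] phi1; split => //.
pose S := [set Normc.normc (phi y) | y in [set y | cnorm y <= 1]].
have S1 : S 1 by exists 1; rewrite /= ?cnorm1 // phi1 Normc.normc1.
have ubS : ubound S `|K|.
  move=> _ [y y1 <-]; apply: le_trans (bK y) _.
  apply: le_trans (ler_wpM2r (cnorm_ge0 _) (ler_norm K)) _.
  by rewrite -[leRHS]mulr1 ler_wpM2l.
have supS : has_sup S by split; [exists 1 | exists `|K|].
have s1 : 1 <= sup S by exact: sup_upper_bound.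
have sle : sup S <= 1.
  suff : sup S <= Num.sqrt (sup S).
    rewrite -{1}[sup S]sqr_sqrtr ?(le_trans ler01) // => h.
    have q0 : 0 < Num.sqrt (sup S) by rewrite sqrtr_gt0 (lt_le_trans ltr01).
    have : Num.sqrt (sup S) <= 1 by rewrite -(ler_pM2l q0) mulr1 -expr2.
    by move=> h1; rewrite -[sup S]sqr_sqrtr ?(le_trans ler01) // expr_le1 // ltW.
  apply: ge_sup; first by exists 1.
  move=> _ [y y1 <-]; rewrite -[leLHS]ger0_norm ?normc_ge0 // -sqrtr_sqr ler_wsqrtr //.
  have := form_CauchySchwarz y 1 pphi; rewrite star1 !mul1r phi1 /= mul1r.
  move=> /le_trans; apply; apply: le_trans (Re_le_normc _) _.
  apply: sup_upper_bound => //; exists (star y * y) => //=.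
  by rewrite cnorm_star_mul expr_le1 // cnorm_ge0.
apply/le_anti/andP; split.
  apply: ge_ereal_sup => _ [y y1 <-]; rewrite lee_fin (le_trans _ sle) //.
  by apply: sup_upper_bound => //; exists y.
by apply: ereal_sup_ubound; exists 1; rewrite /= ?cnorm1 // phi1 Normc.normc1.
Qed.


(** * Passing between a-states and positive bounded functionals *)

Lemma compression1 phi k y : compression phi 1 k y = k * phi y.
Proof. by rewrite /compression star1 mul1r mulr1. Qed.

(** Elements of [a_states] are bare functions; this recovers their linearity, with the quotient by
    [phi a] realized as a compression. *)
Lemma a_states_functional a g : cstar_positive a -> a_states a g ->
  exists psi : {scalar A},
    [/\ positive_functional psi, bounded_functional psi, psi a = 1
      & g = psi].
Proof.
move=> a0 [phi [sphi phia ->]]; exists (compression phi 1 (phi a)^-1).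
have [pphi _] := sphi; split.
- by apply: compression_pos => //; rewrite invr_ge0; exact: pphi.
- exact/compression_bounded/state_bounded.
- by rewrite [LHS]compression1 mulVf.
- by apply/funext => y; rewrite [RHS]compression1 mulrC.
Qed.

(** Dividing [phi] by [phi 1] yields a state and leaves the quotient by the value at [a]
    unchanged. *)
Lemma functional_a_states a phi : positive_functional phi ->
  bounded_functional phi -> phi a != 0 -> a_states a (fun y => phi y / phi a).
Proof.
move=> pphi bphi phia.
have phi10 : 0 <= phi 1 by have := pos_form 1 pphi; rewrite star1 mulr1.
(* By Cauchy-Schwarz, [phi 1] = 0 would force [phi a] = 0. *)
have phi1 : phi 1 != 0.
  apply: contra_neq phia => phi1.
  have := form_CauchySchwarz a 1 pphi; rewrite star1 !mul1r phi1 mul0r => h.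
  apply/Normc.eq0_normc/eqP; rewrite -sqrf_eq0.
  by apply/eqP/le_anti; rewrite h sqr_ge0.
exists (compression phi 1 (phi 1)^-1); split.
- apply: unital_state.
  + by apply: compression_pos => //; rewrite invr_ge0.
  + exact: compression_bounded.
  + by rewrite [LHS]compression1 mulVf.
- by rewrite [X in X != _]compression1 mulf_neq0 ?invr_neq0.
- apply/funext => y; pose i := (phi 1)^-1.
  rewrite -[RHS]/(compression phi 1 i y / compression phi 1 i a) !compression1.
  by rewrite -mulf_div divff ?mul1r ?invr_eq0.
Qed.

(** * Bounding the a-norm of elements z with a z self-adjoint *)

Lemma a_states_form_bound a z (m : R) phi c : cstar_positive a ->
  (forall g, a_states a g -> Normc.normc (g (a * z)) <= m) ->
  positive_functional phi -> bounded_functional phi ->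
  Normc.normc (phi (star c * (a * z) * c)) <=
  m * complex.Re (phi (star c * a * c)).
Proof.
move=> a0 am pphi bphi.
pose psi : {scalar A} := compression phi c 1.
have psiE y : psi y = phi (star c * y * c) by rewrite /psi /= /compression mul1r.
have ppsi : positive_functional psi by apply: compression_pos.
rewrite -!psiE.
have psia : 0 <= psi a by exact: ppsi.
(* If [psi a] = 0, no a-state arises from [psi]; writing a = b^* b, Cauchy-Schwarz for b c and b z c
   shows that the left-hand side vanishes. *)
have [psia0|psia0] := eqVneq (psi a) 0.
  have [b aE] := a0.
  rewrite psia0 mulr0 psiE.
  have -> : star c * (a * z) * c = star (b * c) * (b * (z * c)).
    by rewrite aE starM !mulrA.
  have := form_CauchySchwarz (b * (z * c)) (b * c) pphi.
  have -> : star (b * c) * (b * c) = star c * a * c by rewrite aE starM !mulrA.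
  rewrite -psiE psia0 mul0r => h.
  by rewrite -[leLHS]ger0_norm ?normc_ge0 // -sqrtr_sqr ler0_sqrtr.
have := am _ (functional_a_states ppsi (compression_bounded c 1 bphi) psia0).
rewrite Normc.normcM Normc.normcV.
move: psia psia0; rewrite lecE; case: (psi a) => p p' /= /andP[/eqP-> p0].
rewrite eq_complex /= eqxx andbT => p1.
by rewrite expr0n addr0 sqrtr_sqr ger0_norm // ler_pdivrMr // lt_def p1.
Qed.

(* Polarization: the difference of the two forms [c |-> phi (c^* a z c)] at
   s + z and s - z is [4 s phi (z^* a z)]; then choose s ^ 2 = phi (z^* a z). *)
Lemma a_selfadjoint_norm_bound a z (m : R) phi : cstar_positive a ->
  (forall g, a_states a g -> Normc.normc (g (a * z)) <= m) ->
  positive_functional phi -> bounded_functional phi -> phi a = 1 ->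
  star z * a = a * z ->
  Num.sqrt (complex.Re (phi (star z * a * z))) <= m.
Proof.
move=> a0 am pphi bphi phia saz.
set N := complex.Re _.
pose s := Num.sqrt N; rewrite -/s.
have m0 : 0 <= m.
  have := a_states_form_bound 1 a0 am pphi bphi.
  by rewrite star1 !mul1r !mulr1 phia mulr1; exact/le_trans/normc_ge0.
have N0 : 0 <= N.
  have [b aE] := a0; have := pos_form (b * z) pphi.
  by rewrite starM -mulrA (mulrA (star b)) -aE mulrA lecE => /andP[].
have sN : s ^+ 2 = N by exact: sqr_sqrtr.
have s0 : 0 <= s by exact: sqrtr_ge0.
(* The scalar s as an element of the algebra, so that s + z and s - z make sense there. *)
pose p : A := (s%:C)%C *: 1.
have sp : star p = p by rewrite starZ star1 conjc_real.
have pl y : p * y = (s%:C)%C *: y by rewrite -scalerAl mul1r.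
have pr y : y * p = (s%:C)%C *: y by rewrite -scalerAr mulr1.
have azz : a * z * z = star z * a * z by rewrite saz.
have phiZ k y : phi (k *: y) = k * phi y by rewrite linearZ.
have diff : phi (star (p + z) * (a * z) * (p + z))
    - phi (star (p - z) * (a * z) * (p - z)) = (s *+ 4)%:C%C * phi (star z * a * z).
  rewrite !starD starN sp !mulrDl !mulrDr !mulNr !mulrN !opprK !pl !pr.
  rewrite -!scalerAl !mulrA azz !(linearD phi) !(linearN phi) !phiZ; rewrite rmorphMn /=; ring.
have sum : phi (star (p + z) * a * (p + z)) + phi (star (p - z) * a * (p - z))
    = (s ^+ 2 *+ 2)%:C%C + (1 *+ 2)%:C%C * phi (star z * a * z).
  rewrite !starD starN sp !mulrDl !mulrDr !mulNr !mulrN !opprK !pl !pr.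
  rewrite !(linearD phi) !(linearN phi) !phiZ phia; rewrite !rmorphMn rmorphXn /=; ring.
have := a_states_form_bound (p + z) a0 am pphi bphi.
have := a_states_form_bound (p - z) a0 am pphi bphi.
set U := _ * _ * (p + z) in diff *; set V := _ * _ * (p - z) in diff *.
have := Re_le_normc (phi U); have := Re_le_normc (- phi V).
rewrite normcN; move: (congr1 (@complex.Re R) sum) (congr1 (@complex.Re R) diff).
move: (Normc.normc (phi U)) (Normc.normc (phi V)) N0 sN => nU nV; rewrite /N.
case: (phi U) (phi V) (phi (star z * a * z)) => p1 p1' [p2 p2'] [n n'] /=.
case: (phi _) (phi _) => q1 q1' [q2 q2'] /=; rewrite !mul0r !subr0.
move=> n0 sn e1 e2 h1 h2 h3 h4.
(* Since s ^ 2 = n, the two upper bounds add up to 4 m n, while the difference of the forms is 4 s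
   n; it remains to cancel n. *)
have e3 : m * q2 + m * q1 = m * (4 * n) by rewrite -mulrDr e1 sn; ring.
have sm : s * n <= m * n by lra.
have [n00|n1] := eqVneq n 0.
  by have /eqP := sn; rewrite n00 sqrf_eq0 => /eqP->.
by rewrite -(ler_pM2r (_ : 0 < n)) // lt_def n1.
Qed.

(** For l a square root of w, the element a (l z) is self-adjoint, while replacing z by l z changes
    neither |g (a z)| nor z^* a z. *)
Lemma a_unitary_selfadjoint_norm_bound a z w (m : R) phi : cstar_positive a ->
  (forall g, a_states a g -> Normc.normc (g (a * z)) <= m) ->
  positive_functional phi -> bounded_functional phi -> phi a = 1 ->
  Normc.normc w = 1 -> star z * a = w *: (a * z) ->
  Num.sqrt (complex.Re (phi (star z * a * z))) <= m.
Proof.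
move=> a0 am pphi bphi phia w1 saz.
pose l := sqrtc w; have lw : l ^+ 2 = w := sqr_sqrtc w.
have l1 : Normc.normc l = 1.
  apply/eqP; rewrite -(@pexpr_eq1 _ _ 2) ?normc_ge0 //.
  by rewrite expr2 -Normc.normcM -expr2 lw w1.
have ll : conjc l * l = 1.
  move: l1 (normc_sqr l); case: (l) => r i -> /= e.
  apply/eqP; rewrite eq_complex /=; apply/andP; split; apply/eqP.
    by rewrite expr1n in e; rewrite e; ring.
  ring.
have -> : star z * a * z = star (l *: z) * a * (l *: z).
  by rewrite starZ -!scalerAl -scalerAr scalerA ll scale1r.
apply: a_selfadjoint_norm_bound => //.
- move=> g ag; have [psi [_ _ _ gE]] := a_states_functional a0 ag.
  by rewrite gE -scalerAr linearZ /= Normc.normcM l1 mul1r -gE; exact: am.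
- by rewrite starZ -scalerAl saz scalerA -lw expr2 mulrA ll mul1r scalerAr.
Qed.

(** * The a-adjoint and the elements x + k x^# *)

Lemma star_cstar_positive a : cstar_positive a -> star a = a.
Proof. by move=> [b ->]; rewrite starM starK. Qed.

Lemma a_adjoint_star a x y : cstar_positive a -> a_adjoint a x y ->
  star y * a = a * x.
Proof.
move=> /star_cstar_positive sa xy.
by have := congr1 (@star _ A) xy; rewrite !starM starK sa.
Qed.

Lemma positive_functional_star phi y : positive_functional phi ->
  phi (star y) = conjc (phi y).
Proof. by move=> /(form_conj y 1); rewrite star1 mulr1 mul1r. Qed.

(* Up to a unit scalar, a (x + k x^#) is self-adjoint whenever |k| = 1. *)
Lemma a_norm_rotated_sum a x y k (m : R) phi : cstar_positive a ->
  (forall g, a_states a g -> Normc.normc (g (a * x)) <= m) ->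
  positive_functional phi -> bounded_functional phi -> phi a = 1 ->
  a_adjoint a x y -> conjc k * k = 1 ->
  Num.sqrt (complex.Re (phi (star (x + k *: y) * a * (x + k *: y)))) <= m + m.
Proof.
move=> a0 am pphi bphi phia xy kk.
have k1 : Normc.normc k = 1.
  apply/eqP; rewrite -(@pexpr_eq1 _ _ 2) ?normc_ge0 //.
  by rewrite expr2 -{1}(normc_conj k) -Normc.normcM kk Normc.normc1.
apply: (@a_unitary_selfadjoint_norm_bound _ _ (conjc k)) => //.
- move=> g ag; have [psi [ppsi _ _ gE]] := a_states_functional a0 ag.
  rewrite mulrDr -scalerAr gE linearD linearZ /= (le_trans (le_normcD _ _)) //.
  rewrite Normc.normcM k1 mul1r lerD //; first by rewrite -gE; exact: am.
  (* Here a x^# = x^* a = (a x)^*, so this term has the same modulus as g (a x). *)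
  rewrite xy -{1}(star_cstar_positive a0) -starM positive_functional_star //.
  by rewrite normc_conj -gE; exact: am.
- by rewrite normc_conj.
- rewrite starD starZ mulrDl mulrDr -scalerAl -scalerAr xy (a_adjoint_star a0 xy).
  by rewrite scalerDr scalerA kk scale1r addrC.
Qed.

(** With a = b^* b this is the ordinary Minkowski inequality at b y and b z. *)
Lemma a_norm_Minkowski a y z phi : cstar_positive a -> positive_functional phi ->
  Num.sqrt (complex.Re (phi (star (y + z) * a * (y + z)))) <=
  Num.sqrt (complex.Re (phi (star y * a * y))) +
  Num.sqrt (complex.Re (phi (star z * a * z))).
Proof.
move=> [b ->] pphi.
have E u : star u * (star b * b) * u = star (b * u) * (b * u).
  by rewrite starM !mulrA.
by rewrite !E mulrDr; exact: form_Minkowski.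
Qed.

End PositiveFunctionals.

(** * From bounds on single a-states to the extended-real inequality *)

Theorem theorem3p10 (R : realType) (A : cstarAlgebra R) (a : A)
    (a_neq0 : a != 0) (a_pos : cstar_positive a)
    (x : A) (x_adj : a_adjointable a x)
    (xs : A) (xsP : a_adjoint a x xs) :
  ((2^-1)%:E * a_norm a x
   + (4^-1)%:E * `| a_norm a (x + ('i%C : R[i]) *: xs)
                    - a_norm a (x - ('i%C : R[i]) *: xs) |
   <= a_numerical_radius a x)%E.
Proof.
(* Without a-states the supremum [a_norm a x] is -oo, which absorbs the whole left-hand side. *)
have [S0|S0] := eqVneq (a_states a) set0.
  rewrite {1}/a_norm S0 image_set0 ereal_sup0 gt0_muleNy ?lte_fin ?invr_gt0 //.
  by rewrite addNye leNye.
have {S0}[g0 ag0] : a_states a !=set0 by exact/set0P.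
have lb : ((Normc.normc (g0 (a * x)))%:E <= a_numerical_radius a x)%E.
  by apply: ereal_sup_ubound; exists g0.
have ub g : a_states a g ->
    ((Normc.normc (g (a * x)))%:E <= a_numerical_radius a x)%E.
  by move=> ag; apply: ereal_sup_ubound; exists g.
(* The value -oo contradicts [lb], and +oo makes the claim trivial. *)
move: lb ub; case: (a_numerical_radius a x) => [m| |] // _ ub.
  2: by rewrite leey.
have am g : a_states a g -> Normc.normc (g (a * x)) <= m by move=> /ub.
pose N (g : A -> R[i]) y := Num.sqrt (complex.Re (g (star y * a * y))).
have N_le y g : a_states a g -> ((N g y)%:E <= a_norm a y)%E.
  by move=> ag; apply: ereal_sup_ubound; exists g.
have norm_le y (M : R) : (forall g, a_states a g -> N g y <= M) ->
    (a_norm a y <= M%:E)%E.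
  by move=> h; apply: ge_ereal_sup => _ [g ag <-]; rewrite lee_fin h.
have norm_fin y (M : R) : (forall g, a_states a g -> N g y <= M) ->
    exists2 p : R, a_norm a y = p%:E & p <= M.
  move=> /norm_le h; have := N_le y _ ag0.
  by move: h; case: (a_norm a y) => [p| |] // pM _; exists p.
have pm_le k g : conjc k * k = 1 -> a_states a g -> N g (x + k *: xs) <= m + m.
  move=> kk /(a_states_functional a_pos)[phi [pphi bphi phia ->]].
  exact: a_norm_rotated_sum.
have ii : conjc 'i%C * 'i%C = 1 :> R[i].
  by apply/eqP; rewrite eq_complex /=; apply/andP; split; apply/eqP; ring.
have nii : conjc (- 'i%C) * - 'i%C = 1 :> R[i] by rewrite rmorphN mulrNN.
have [p pE pm] := norm_fin _ _ (fun g => pm_le _ g ii).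
have [q qE qm] := norm_fin _ _ (fun g => pm_le _ g nii).
rewrite scaleNr in qE.
have x_le g : a_states a g -> N g x <= (p + q) / 2.
  move=> ag; have := N_le (x + 'i%C *: xs) _ ag; have := N_le (x - 'i%C *: xs) _ ag.
  rewrite pE qE !lee_fin.
  have [phi [pphi _ _ ->]] := a_states_functional a_pos ag.
  (* The two elements sum to 2 x. *)
  have := a_norm_Minkowski (x + 'i%C *: xs) (x - 'i%C *: xs) a_pos pphi.
  rewrite -/(N phi _) -/(N phi _) -/(N phi _) addrACA subrr addr0.
  have -> : N phi (x + x) = 2 * N phi x.
    rewrite /N [in LHS]starD ![in LHS]mulrDl ![in LHS]mulrDr ![in LHS]linearD.
    case: (phi _) => r r' /=; have -> : r + r + (r + r) = 2 ^+ 2 * r by ring.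
    by rewrite sqrtrM ?sqr_ge0 // sqrtr_sqr ger0_norm.
  lra.
have [n nE npq] := norm_fin _ _ x_le.
rewrite nE pE qE -EFinB -!EFinM -EFinD lee_fin.
(* As n is at most (p + q) / 2, the left-hand side is at most max(p, q) / 2, hence at most m. *)
by case: (lerP q p) => ?; lra.
Qed.
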